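(* For $\mathbf x=(\mathbf x(0),\mathbf x(1))\in\mathbb C^2$ let $\widehat{\mathbf x}(\omega)=\frac1{\sqrt2}\sum_{t=0}^1 e^{i\pi t\omega}\mathbf x(t)$, $\omega=0,1$. Let $$\mathbf B=\{\mathbf x\in\mathbb C^2:|\widehat{\mathbf x}(0)|=1,\ |\widehat{\mathbf x}(1)|=1\},\qquad \mathbf F=\{\mathbf x\in\mathbb C^2:|\widehat{\mathbf x}(0)|=1,\ \mathrm{Re}\,\widehat{\mathbf x}(1)=0,\ \mathrm{Im}\,\widehat{\mathbf x}(1)=1\},$$ $$\mathbf A=\big\{\mathbf x\in\mathbb C^2:\ \widehat{\mathbf x}(0)=(1+s^2)e^{-2i\ln s},\ \widehat{\mathbf x}(1)=s+i\sqrt{1-s^2}\ \text{ for some } 0<s\le1\big\}\cup\mathbf F.$$ Then every Gerchberg-Saxton error reduction sequence $\mathbf x_k\in\mathbf A$, $\mathbf y_k\in\mathbf B$ for the magnitude set $\mathbf B$ and the prior set $\mathbf A$, started at a point of $\mathbf A\setminus\mathbf F$, fails to converge, even though $\mathbf x_k-\mathbf x_{k+1}\to0$, $\mathbf y_k-\mathbf y_{k+1}\to0$ and $\mathbf x_k-\mathbf y_k\to0$. Every $\mathbf x^*\in\mathbf F$ is an accumulation point of the sequences $\mathbf x_k$ and $\mathbf y_k$, and is an exact solution of the phase retrieval problem, i.e. $\mathbf x^*\in\mathbf A\cap\mathbf B$.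
   Context: $\mathbb C^2$ is identified with $\mathbb R^4$ with the Euclidean norm. Gerchberg-Saxton error reduction for $\mathbf A,\mathbf B$ is the alternating projection method $\mathbf y_k\in P_{\mathbf B}(\mathbf x_k)$, $\mathbf x_{k+1}\in P_{\mathbf A}(\mathbf y_k)$, with $P_{\mathbf A},P_{\mathbf B}$ the (possibly set-valued) orthogonal projectors. *)

(* Defs.v *)
From Stdlib Require Import Reals.
From Coquelicot Require Import Coquelicot.
Open Scope R_scope.

(* [norm] on this real normed module is
   sqrt (Re x0 ^ 2 + Im x0 ^ 2 + Re x1 ^ 2 + Im x1 ^ 2) up to nested square
   roots, i.e. the Euclidean norm of R^4; [locally] is the usual topology. *)
Definition C2 : NormedModule R_AbsRing :=
  prod_NormedModule R_AbsRing C_R_NormedModule C_R_NormedModule.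

(* Values t >= 1 all give the second coordinate; only t = 0, 1 is used. *)
Definition coord (x : C2) (t : nat) : C :=
  match t with O => fst x | S _ => snd x end.

(* e^{i theta} for real theta; Coquelicot has no complex exponential. *)
Definition expi (theta : R) : C := (cos theta, sin theta).

Definition dft (x : C2) (w : nat) : C :=
  (RtoC (/ sqrt 2) *
   sum_n_m (fun t : nat => expi (PI * INR t * INR w) * coord x t) 0 1)%C.

(* [proj A x a] reads "a belongs to P_A(x)", the set of all nearest points. *)
Definition proj (A : C2 -> Prop) (x a : C2) : Prop :=
  A a /\ forall a' : C2, A a' -> norm (minus x a) <= norm (minus x a').

Definition gerchberg_saxton (A B : C2 -> Prop) (x y : nat -> C2) : Prop :=
  A (x 0%nat) /\
  forall k : nat, proj B (x k) (y k) /\ proj A (y k) (x (S k)).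

Definition setB (x : C2) : Prop :=
  Cmod (dft x 0) = 1 /\ Cmod (dft x 1) = 1.

Definition setF (x : C2) : Prop :=
  Cmod (dft x 0) = 1 /\ Re (dft x 1) = 0 /\ Im (dft x 1) = 1.

Definition setA (x : C2) : Prop :=
  (exists s : R, 0 < s <= 1 /\
     dft x 0 = (RtoC (1 + s ^ 2) * expi (- 2 * ln s))%C /\
     dft x 1 = (RtoC s + Ci * RtoC (sqrt (1 - s ^ 2)))%C)
  \/ setF x.

Definition converges_to (u : nat -> C2) (l : C2) : Prop :=
  filterlim u eventually (locally l).

Definition accumulation_point (u : nat -> C2) (l : C2) : Prop :=
  forall V : C2 -> Prop, locally l V ->
  forall N : nat, exists n : nat, (N <= n)%nat /\ V (u n).

(* Main.v *)
Require Import Defs.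
From Stdlib Require Import Reals Lra Lia Psatz.
From Coquelicot Require Import Coquelicot.
Open Scope R_scope.

(** The discrete Fourier transform is unitary, so distances can be computed on
    [dft x 0] and [dft x 1].  If [x k] is the point of the arc with parameter
    [r], projecting it on [setB] only rescales [dft x 0] to modulus 1 and moves
    it by [r ^ 2].  Minimality of [x (k+1)] then excludes [setF], at distance more
    than [r], and forces the new parameter [s] to satisfy [s <= r] and
    [r - s <= r ^ 2].  A positive limit of the parameters would minimize the
    distance to its own projection, which a first-order decrease along the arc
    rules out; hence the parameters tend to 0.  The phase [-2 ln s] thus
    increases to infinity with steps tending to 0, so it is dense modulo
    [2 PI]. *)

(** * Fourier coefficients as isometric coordinates *)

Definition sqdist (u v : C) : R := (Re u - Re v) ^ 2 + (Im u - Im v) ^ 2.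

Lemma dft_0 (x : C2) : dft x 0 = (RtoC (/ sqrt 2) * (fst x + snd x))%C.
Proof.
  unfold dft. rewrite sum_n_Sm by auto. rewrite sum_n_n. cbn [coord INR].
  replace (PI * 0 * 0) with 0 by ring. replace (PI * 1 * 0) with 0 by ring. unfold expi. rewrite cos_0, sin_0.
  apply f_equal. change plus with Cplus. change (1,0) with (RtoC 1). now rewrite !Cmult_1_l.
Qed.

Lemma dft_1 (x : C2) : dft x 1 = (RtoC (/ sqrt 2) * (fst x - snd x))%C.
Proof.
  unfold dft. rewrite sum_n_Sm by auto. rewrite sum_n_n. cbn [coord INR].
  replace (PI * 0 * 1) with 0 by ring. replace (PI * 1 * 1) with PI by ring. unfold expi. rewrite cos_0, sin_0, cos_PI, sin_PI.
  apply f_equal. change plus with Cplus.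
  destruct (fst x), (snd x); unfold Cminus, Cplus, Copp, Cmult, RtoC;
    apply injective_projections; cbn [fst snd]; ring.
Qed.

(** The two-point transform is an involution, so the witness is the transform of the pair [u],
    [v]. *)
Lemma dft_surjective (u v : C) : exists x : C2, dft x 0 = u /\ dft x 1 = v.
Proof.
  exists ((RtoC (/ sqrt 2) * (u + v))%C, (RtoC (/ sqrt 2) * (u - v))%C).
  rewrite dft_0, dft_1; cbn [fst snd].
  assert (H : / sqrt 2 * / sqrt 2 = / 2).
  { rewrite <- Rinv_mult, sqrt_sqrt; lra. }
  set (h := / sqrt 2) in *.
  destruct u as [u0 u1], v as [v0 v1].
  unfold Cminus, Cplus, Copp, Cmult, RtoC; simpl.
  split; apply injective_projections; cbn [fst snd];
    match goal with |- _ = ?w => transitivity (2 * (h * h) * w); [ring | rewrite H; field] end.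
Qed.

(** Parseval, from the parallelogram law; the square of [/ sqrt 2] cancels its factor 2. *)
Lemma sqr_norm_minus (x y : C2) :
  norm (minus x y) ^ 2 = sqdist (dft x 0) (dft y 0) + sqdist (dft x 1) (dft y 1).
Proof.
  rewrite !dft_0, !dft_1.
  destruct x as [[a b] [c d]], y as [[a' b'] [c' d']].
  change (norm (minus _ _)) with
    (sqrt (sqrt (Rabs (a + - a') ^ 2 + Rabs (b + - b') ^ 2) ^ 2 +
           sqrt (Rabs (c + - c') ^ 2 + Rabs (d + - d') ^ 2) ^ 2)).
  rewrite !pow2_sqrt, !pow2_abs by nra.
  assert (H : / sqrt 2 * / sqrt 2 = / 2).
  { rewrite <- Rinv_mult, sqrt_sqrt; lra. }
  set (h := / sqrt 2) in *.
  unfold sqdist, Cminus, Cplus, Copp, Cmult, RtoC, Re, Im; cbn [fst snd].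
  transitivity (2 * (h * h) * ((a + - a') ^ 2 + (b + - b') ^ 2 + ((c + - c') ^ 2 + (d + - d') ^ 2))).
  - rewrite H; field.
  - ring.
Qed.

Lemma sqdist_le_of_norm_le (x y z w : C2) :
  norm (minus x y) <= norm (minus z w) ->
  sqdist (dft x 0) (dft y 0) + sqdist (dft x 1) (dft y 1) <=
  sqdist (dft z 0) (dft w 0) + sqdist (dft z 1) (dft w 1).
Proof.
  intros H. rewrite <- !sqr_norm_minus. apply pow_incr. split; [apply norm_ge_0 | exact H].
Qed.

(** * The arc and its projection onto [setB] *)

Definition on_arc (s : R) (x : C2) : Prop :=
  0 < s <= 1 /\
  dft x 0 = (RtoC (1 + s ^ 2) * expi (- 2 * ln s))%C /\
  dft x 1 = (RtoC s + Ci * RtoC (sqrt (1 - s ^ 2)))%C.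

Lemma on_arc_exists (s : R) : 0 < s <= 1 -> exists x, on_arc s x.
Proof.
  intros Hs. destruct (dft_surjective (RtoC (1 + s ^ 2) * expi (- 2 * ln s))%C
    (RtoC s + Ci * RtoC (sqrt (1 - s ^ 2)))%C) as [x Hx].
  exists x; split; assumption.
Qed.

Lemma on_arc_coords (s : R) (x : C2) : on_arc s x ->
  dft x 0 = ((1 + s ^ 2) * cos (-2 * ln s), (1 + s ^ 2) * sin (-2 * ln s)) /\
  dft x 1 = (s, sqrt (1 - s ^ 2)).
Proof.
  intros (_ & -> & ->).
  split; apply injective_projections; simpl; ring.
Qed.

Lemma Cmod_1_sqr (z : C) : Cmod z = 1 <-> Re z ^ 2 + Im z ^ 2 = 1.
Proof.
  unfold Cmod, Re, Im. split; intros H.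
  - rewrite <- (pow2_sqrt (fst z ^ 2 + snd z ^ 2)), H by nra. ring.
  - rewrite H. apply sqrt_1.
Qed.

Lemma sqr_sqrt_1_minus (s : R) : 0 <= s <= 1 -> sqrt (1 - s ^ 2) ^ 2 = 1 - s ^ 2.
Proof. intros; apply pow2_sqrt; nra. Qed.

(** The projection onto [setB] of the arc point with parameter [s]: the first coefficient is
    rescaled to modulus 1, the second already has it. *)
Definition shadow (s : R) (y : C2) : Prop :=
  dft y 0 = expi (-2 * ln s) /\ dft y 1 = (s, sqrt (1 - s ^ 2)).

Lemma sqr_cos_sin (t : R) : cos t ^ 2 + sin t ^ 2 = 1.
Proof. generalize (sin2_cos2 t); unfold Rsqr; lra. Qed.

Lemma proj_setB_on_arc (s : R) (x y : C2) :
  on_arc s x -> proj setB x y -> shadow s y.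
Proof.
  intros Hx [[Hy0 Hy1] Hmin].
  assert (Hs := proj1 Hx).
  destruct (on_arc_coords s x Hx) as [E0 E1].
  assert (Hq := sqr_sqrt_1_minus s ltac:(lra)).
  assert (Hu := sqr_cos_sin (-2 * ln s)).
  destruct (dft_surjective (expi (-2 * ln s)) (s, sqrt (1 - s ^ 2))) as [b [Eb0 Eb1]].
  assert (Hb : setB b).
  { unfold setB. rewrite Eb0, Eb1, !Cmod_1_sqr. unfold expi, Re, Im; cbn [fst snd]. split; lra. }
  specialize (Hmin b Hb). apply sqdist_le_of_norm_le in Hmin.
  rewrite E0, E1, Eb0, Eb1 in Hmin.
  apply Cmod_1_sqr in Hy0, Hy1.
  unfold shadow. destruct (dft y 0) as [p q], (dft y 1) as [p' q'].
  unfold sqdist, expi, Re, Im in *; cbn [fst snd] in *.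
  set (c := cos (-2 * ln s)) in *. set (d := sin (-2 * ln s)) in *.
  set (w := sqrt (1 - s ^ 2)) in *.
  (* For unit vectors [u], [z]: [|(1 + s^2) u - z|^2 = (1 + s^2) |z - u|^2 + s^4], and [s^4] is the
     squared distance to the candidate [b]. Minimality thus makes every remaining square vanish. *)
  assert (H : (1 + s ^ 2) * ((p - c) ^ 2 + (q - d) ^ 2) + ((s - p') ^ 2 + (w - q') ^ 2) <= 0).
  { assert (E : ((1 + s ^ 2) * c - p) ^ 2 + ((1 + s ^ 2) * d - q) ^ 2 =
      (1 + s ^ 2) * ((p - c) ^ 2 + (q - d) ^ 2) +
      (1 + s ^ 2) * s ^ 2 * (c ^ 2 + d ^ 2) - s ^ 2 * (p ^ 2 + q ^ 2)) by ring.
    rewrite E, Hu, Hy0 in Hmin.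
    replace (((1 + s ^ 2) * c - c) ^ 2 + ((1 + s ^ 2) * d - d) ^ 2)
      with (s ^ 4 * (c ^ 2 + d ^ 2)) in Hmin by ring.
    rewrite Hu in Hmin. lra. }
  assert (0 <= (p - c) ^ 2) by apply pow2_ge_0.
  assert (0 <= (q - d) ^ 2) by apply pow2_ge_0.
  assert (0 <= (s - p') ^ 2) by apply pow2_ge_0.
  assert (0 <= (w - q') ^ 2) by apply pow2_ge_0.
  assert (0 <= s ^ 2 * ((p - c) ^ 2 + (q - d) ^ 2)) by (apply Rmult_le_pos; nra).
  assert (E : forall a b : R, (a - b) ^ 2 <= 0 -> a = b) by (intros; nra).
  assert (p = c) as -> by (apply E; lra).
  assert (q = d) as -> by (apply E; lra).
  assert (s = p') as <- by (apply E; lra).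
  assert (w = q') as <- by (apply E; lra).
  split; reflexivity.
Qed.

(** * The function [gap] and one step of the iteration *)

(* Squared distance from the point of the arc with parameter [t] to the shadow
   on [setB] of the point with parameter [r]. *)
Definition gap (t r : R) : R :=
  t ^ 4 + 2 * (1 + t ^ 2) * (1 - cos (2 * (ln t - ln r))) +
  ((t - r) ^ 2 + (sqrt (1 - t ^ 2) - sqrt (1 - r ^ 2)) ^ 2).

Lemma gap_diag (r : R) : gap r r = r ^ 4.
Proof. unfold gap. rewrite !Rminus_diag, Rmult_0_r, cos_0. ring. Qed.

(** Law of cosines in the first coefficient, for the radii [1] and [1 + t^2]. *)
Lemma sqr_norm_shadow_arc (t r : R) (a y : C2) :
  on_arc t a -> shadow r y -> norm (minus y a) ^ 2 = gap t r.
Proof.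
  intros Ha [Ey0 Ey1]. destruct (on_arc_coords t a Ha) as [Ea0 Ea1].
  rewrite sqr_norm_minus, Ea0, Ea1, Ey0, Ey1.
  unfold sqdist, gap, expi, Re, Im; cbn [fst snd].
  replace (2 * (ln t - ln r)) with (-2 * ln r - -2 * ln t) by ring.
  rewrite cos_minus.
  assert (Hr := sqr_cos_sin (-2 * ln r)). assert (Ht := sqr_cos_sin (-2 * ln t)).
  set (c := cos (-2 * ln r)) in *. set (d := sin (-2 * ln r)) in *.
  set (c' := cos (-2 * ln t)) in *. set (d' := sin (-2 * ln t)) in *.
  transitivity ((c ^ 2 + d ^ 2) + (1 + t ^ 2) ^ 2 * (c' ^ 2 + d' ^ 2) -
    2 * (1 + t ^ 2) * (c * c' + d * d') +
    ((t - r) ^ 2 + (sqrt (1 - t ^ 2) - sqrt (1 - r ^ 2)) ^ 2)); [ring |].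
  rewrite Hr, Ht. ring.
Qed.

Lemma norm_shadow_self (s : R) (x y : C2) :
  on_arc s x -> shadow s y -> norm (minus y x) = s ^ 2.
Proof.
  intros Hx Hy. assert (H := sqr_norm_shadow_arc s s x y Hx Hy).
  rewrite gap_diag in H. assert (0 <= norm (minus y x)) by apply norm_ge_0.
  nra.
Qed.

Lemma setA_cases (x : C2) : setA x -> (exists s, on_arc s x) \/ setF x.
Proof. intros [[s H] | H]; [left; exists s; exact H | right; exact H]. Qed.

Lemma on_arc_setA (s : R) (x : C2) : on_arc s x -> setA x.
Proof. intros H; left; exists s; exact H. Qed.

(** On [setF] the second coefficient is [i], already farther than [r] from that of [y], while the
    arc point with parameter [r] is at distance [r^2]. *)
Lemma not_setF_proj (r : R) (y a : C2) :
  0 < r <= 1 -> shadow r y -> proj setA y a -> ~ setF a.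
Proof.
  intros Hr Hy [_ Hmin] (_ & Ha0 & Ha1).
  destruct (on_arc_exists r Hr) as [x Hx].
  specialize (Hmin x (on_arc_setA r x Hx)). rewrite (norm_shadow_self r x y Hx Hy) in Hmin.
  apply (fun H => pow_incr _ _ 2 (conj (norm_ge_0 _) H)) in Hmin.
  rewrite sqr_norm_minus, (proj1 Hy), (proj2 Hy) in Hmin.
  assert (Hq := sqr_sqrt_1_minus r ltac:(lra)).
  assert (Hq0 := sqrt_pos (1 - r ^ 2)).
  unfold sqdist in Hmin. rewrite Ha0, Ha1 in Hmin.
  unfold expi, Re, Im in Hmin; cbn [fst snd] in Hmin.
  set (w := sqrt (1 - r ^ 2)) in *.
  assert (H0 : forall a : R, 0 <= a ^ 2) by apply pow2_ge_0.
  pose proof (H0 (cos (-2 * ln r) - fst (dft a 0))).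
  pose proof (H0 (sin (-2 * ln r) - snd (dft a 0))).
  pose proof (H0 (w - 1)).
  assert (0 < r ^ 2 <= 1) by nra.
  (* The right side is at most [r^2], so [w = 1]; then [w^2 = 1 - r^2] contradicts [0 < r]. *)
  assert (Hle : r ^ 2 + (w - 1) ^ 2 <= (r ^ 2) ^ 2) by lra.
  assert (w = 1) by nra.
  nra.
Qed.

(** Reduces one iteration to a minimization in one real variable, the form used from here on. *)
Lemma error_reduction_step (r : R) (x y x' : C2) :
  on_arc r x -> proj setB x y -> proj setA y x' ->
  exists s, on_arc s x' /\ forall t, 0 < t <= 1 -> gap s r <= gap t r.
Proof.
  intros Hx Hy Hx'. assert (Hs := proj_setB_on_arc r x y Hx Hy).
  assert (Hr := proj1 Hx).
  destruct (setA_cases x' (proj1 Hx')) as [[s Hs'] | HF].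
  - exists s; split; [assumption |]. intros t Ht.
    destruct (on_arc_exists t Ht) as [a Ha].
    rewrite <- (sqr_norm_shadow_arc s r x' y Hs' Hs), <- (sqr_norm_shadow_arc t r a y Ha Hs).
    apply pow_incr; split; [apply norm_ge_0 |].
    apply (proj2 Hx'). exact (on_arc_setA t a Ha).
  - exfalso; exact (not_setF_proj r y x' Hr Hs Hx' HF).
Qed.

Lemma gap_lower_bounds (s r : R) : 0 < s ->
  s ^ 4 <= gap s r /\ (s - r) ^ 2 <= gap s r.
Proof.
  intros Hs. assert (Hc := COS_bound (2 * (ln s - ln r))). unfold gap.
  assert (0 <= 2 * (1 + s ^ 2) * (1 - cos (2 * (ln s - ln r)))).
  { apply Rmult_le_pos; nra. }
  assert (0 <= (sqrt (1 - s ^ 2) - sqrt (1 - r ^ 2)) ^ 2) by apply pow2_ge_0.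
  assert (0 <= (s - r) ^ 2) by apply pow2_ge_0.
  assert (0 <= s ^ 4) by (apply pow_le; lra).
  lra.
Qed.

(** Since [gap r r = r^4], the radial summand [s^4] yields the first bound and [(s - r)^2] the
    second. *)
Lemma argmin_gap_bounds (s r : R) :
  0 < s -> 0 < r -> gap s r <= gap r r -> s <= r /\ r - s <= r ^ 2.
Proof.
  intros Hs Hr H. rewrite gap_diag in H.
  destruct (gap_lower_bounds s r Hs) as [H1 H2].
  split; [| nra].
  destruct (Rle_lt_dec s r) as [| C]; [assumption |].
  assert (r ^ 2 < s ^ 2) by nra. nra.
Qed.

(** * Convergence of the parameters to 0 *)

Lemma decrease_left (f : R -> R) (x l : R) :
  0 < x -> is_derive f x l -> 0 < l -> exists t, 0 < t < x /\ f t < f x.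
Proof.
  intros Hx Hd Hl. apply is_derive_Reals in Hd.
  (* Tolerance [l] keeps the difference quotient positive, so a short step to the left lowers
     [f]. *)
  destruct (Hd l Hl) as [[d Hd0] H]; simpl in H.
  set (m := Rmin d x / 2).
  assert (Hm : 0 < m /\ m < d /\ m < x).
  { unfold m, Rmin; destruct (Rle_dec d x); lra. }
  exists (x + - m). split; [lra |].
  assert (H' : Rabs ((f (x + - m) - f x) / - m - l) < l).
  { apply H; [lra |]. rewrite Rabs_Ropp, Rabs_pos_eq; lra. }
  apply Rabs_lt_between in H'.
  assert (0 < (f (x + - m) - f x) / - m) by lra.
  assert (f (x + - m) - f x = (f (x + - m) - f x) / - m * - m) by (field; lra).
  nra.
Qed.

(** For [l < 1] every summand except [t^4] is stationary at [t = l], which leaves the slope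
    [4 l^3]. *)
Lemma gap_decrease (l : R) : 0 < l <= 1 -> exists t, 0 < t < l /\ gap t l < gap l l.
Proof.
  intros Hl. destruct (Req_dec l 1) as [-> | Hl1].
  (* At [l = 1] the square root has a vertical tangent, but its square plus [(t - 1)^2] is
     [2 - 2 t]; the slope is [4 - 2]. *)
  - set (g t := t ^ 4 + 2 * (1 + t ^ 2) * (1 - cos (2 * ln t)) + (2 - 2 * t)).
    destruct (decrease_left g 1 2) as [t [Ht Hg]]; [lra | | lra |].
    + unfold g. auto_derive; [lra |]. rewrite ln_1, Rmult_0_r, cos_0, sin_0. field.
    + assert (E : forall u, 0 <= u <= 1 -> gap u 1 = g u).
      { intros u Hu. unfold gap, g. rewrite ln_1, Rminus_0_r.
        replace (1 - 1 ^ 2) with 0 by ring. rewrite sqrt_0, Rminus_0_r, sqr_sqrt_1_minus by assumption.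
        ring. }
      exists t; rewrite !E by lra. split; [lra | exact Hg].
  - apply (decrease_left (fun t => gap t l)) with (4 * l ^ 3); [lra | | assert (0 < l ^ 3) by (apply pow_lt; lra); lra].
    unfold gap. assert (0 < 1 - l ^ 2) by nra.
    auto_derive; [repeat split; lra |].
    rewrite !Rplus_opp_r, Rmult_0_r, cos_0, sin_0. ring.
Qed.

Lemma continuous_gap (t r : R) : 0 < r -> continuity_pt (gap t) r.
Proof.
  intros Hr. apply continuity_pt_filterlim. unfold gap.
  apply (continuous_plus (V := R_NormedModule)
    (fun r => t ^ 4 + 2 * (1 + t ^ 2) * (1 - cos (2 * (ln t - ln r))))
    (fun r => (t - r) ^ 2 + (sqrt (1 - t ^ 2) - sqrt (1 - r ^ 2)) ^ 2));
    [| apply (continuous_plus (V := R_NormedModule)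
         (fun r => (t - r) ^ 2) (fun r => (sqrt (1 - t ^ 2) - sqrt (1 - r ^ 2)) ^ 2))].
  - apply (ex_derive_continuous (V := R_NormedModule)). auto_derive; lra.
  - apply (ex_derive_continuous (V := R_NormedModule)). auto_derive; trivial.
  (* At [r = 1] the root is not differentiable, so mere continuity of [sqrt] is used. *)
  - apply (continuous_comp (fun u => sqrt (1 - u ^ 2)) (fun w => (sqrt (1 - t ^ 2) - w) ^ 2)).
    + apply (continuous_comp (fun u => 1 - u ^ 2) sqrt).
      * apply (ex_derive_continuous (V := R_NormedModule)). auto_derive; trivial.
      * apply continuous_sqrt.
    + apply (ex_derive_continuous (V := R_NormedModule)). auto_derive; trivial.
Qed.

(** For a limit [l > 0], [gap_decrease] gives [t] with [gap t l < l^4], whereas [l^4 <= s (S k) ^ 4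
    <= gap (s (S k)) (s k) <= gap t (s k)], which tends to [gap t l]. *)
Lemma argmin_gap_lim (s : nat -> R) :
  (forall k, 0 < s k <= 1) ->
  (forall k t, 0 < t <= 1 -> gap (s (S k)) (s k) <= gap t (s k)) ->
  is_lim_seq s 0.
Proof.
  intros Hs Hmin.
  assert (Hdec : forall k, s (S k) <= s k).
  { intros k. apply argmin_gap_bounds; [apply Hs | apply Hs | apply Hmin, Hs]. }
  destruct (ex_finite_lim_seq_decr s 0 Hdec) as [l Hl].
  { intros k; apply Rlt_le, Hs. }
  assert (Hle := is_lim_seq_decr_compare s l Hl Hdec).
  destruct (Rle_lt_dec l 0) as [Hl0 | Hl0].
  - assert (0 <= l).
    { apply (is_lim_seq_le (fun _ => 0) s 0 l); [| apply is_lim_seq_const | exact Hl].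
      intros k; apply Rlt_le, Hs. }
    replace 0 with l by lra. exact Hl.
  - exfalso.
    assert (Hl1 : l <= 1) by (apply Rle_trans with (s 0%nat); [apply Hle | apply Hs]).
    destruct (gap_decrease l) as [t [Ht Hgap]]; [lra |].
    rewrite gap_diag in Hgap.
    apply (Rlt_irrefl (gap t l)). apply Rlt_le_trans with (1 := Hgap).
    apply (is_lim_seq_le (fun _ => l ^ 4) (fun k => gap t (s k)) (l ^ 4) (gap t l)).
    + intros k. apply Rle_trans with (gap (s (S k)) (s k)); [| apply Hmin; lra].
      apply Rle_trans with (s (S k) ^ 4).
      * apply pow_incr; split; [lra | apply Hle].
      * apply gap_lower_bounds, Hs.
    + apply is_lim_seq_const.
    + apply is_lim_seq_continuous; [now apply continuous_gap | exact Hl].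
Qed.

(** * Density of the phase modulo [2 PI] *)

(* Every level above [theta N] is crossed, and by a step that is short. *)
Lemma slowly_divergent_phase_dense (theta : nat -> R) :
  (forall M, exists N, forall n, (N <= n)%nat -> M < theta n) ->
  (forall eps, 0 < eps -> exists N, forall n, (N <= n)%nat -> theta (S n) - theta n < eps) ->
  forall phi eps N, 0 < eps -> exists n, (N <= n)%nat /\ 1 - cos (theta n - phi) < eps.
Proof.
  intros Hinf Hslow phi eps N Heps.
  destruct (continuity_cos 0 eps Heps) as [d [Hd Hcos]].
  destruct (Hslow d Hd) as [N1 HN1]. set (N2 := max N N1).
  destruct (INR_unbounded ((theta N2 - phi) / (2 * PI))) as [m Hm].
  (* The level [T] is [phi] lifted by [m] full turns above [theta N2]. *)
  assert (HPI := PI_RGT_0). set (T := phi + 2 * INR m * PI).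
  assert (HT : theta N2 < T).
  { apply (Rmult_lt_compat_r (2 * PI)) in Hm; [| lra].
    unfold Rdiv in Hm. rewrite Rmult_assoc, Rinv_l, Rmult_1_r in Hm by lra. unfold T; lra. }
  assert (Hcross : exists n, (N2 <= n)%nat /\ theta n <= T < theta (S n)).
  { destruct (Hinf T) as [N3 HN3].
    (* Without a crossing the sequence would stay below [T] forever, against its divergence. *)
    assert (Hall : forall j, theta (N2 + j)%nat <= T \/
      exists n, (N2 <= n)%nat /\ theta n <= T < theta (S n)).
    { induction j as [| j [IH | IH]].
      - left. rewrite Nat.add_0_r. lra.
      - destruct (Rle_lt_dec (theta (N2 + S j)%nat) T) as [| C]; [left; assumption | right].
        exists (N2 + j)%nat. rewrite Nat.add_succ_r in C. split; [lia | lra].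
      - right; exact IH. }
    destruct (Hall N3) as [C |]; [| assumption].
    specialize (HN3 (N2 + N3)%nat ltac:(lia)). lra. }
  destruct Hcross as [n [Hn Hc]]. exists n. split; [lia |].
  specialize (HN1 n ltac:(lia)).
  replace (cos (theta n - phi)) with (cos (theta n - T)).
  2: { rewrite <- (cos_period (theta n - T) m). f_equal. unfold T; ring. }
  (* The neighbourhood in the definition of continuity is punctured, so equality is treated
     apart. *)
  destruct (Req_dec (theta n) T) as [-> |].
  - rewrite Rminus_diag, cos_0. lra.
  - specialize (Hcos (theta n - T)). simpl in Hcos. unfold R_dist in Hcos.
    rewrite cos_0, Rminus_0_r in Hcos.
    assert (H' : Rabs (cos (theta n - T) - 1) < eps).
    { apply Hcos. split; [split; [exact I | lra] |].
      rewrite Rabs_left1; lra. }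
    apply Rabs_lt_between in H'. lra.
Qed.

(** [acos] only covers the upper half circle; the sign of the imaginary part selects the sign of the
    angle. *)
Lemma unit_circle_arg (z : C) : Cmod z = 1 -> exists phi, z = expi phi.
Proof.
  rewrite Cmod_1_sqr. destruct z as [c d]; unfold Re, Im; cbn [fst snd]; intros H.
  assert (Hc : -1 <= c <= 1) by nra.
  assert (E : sqrt (1 - c²) = Rabs d).
  { rewrite <- sqrt_Rsqr_abs. f_equal. unfold Rsqr. lra. }
  destruct (Rle_dec 0 d).
  - exists (acos c). unfold expi.
    rewrite cos_acos, sin_acos, E, Rabs_pos_eq by lra. reflexivity.
  - exists (- acos c). unfold expi.
    rewrite cos_neg, sin_neg, cos_acos, sin_acos, E, Rabs_left by lra.
    now rewrite Ropp_involutive.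
Qed.

Lemma dist_shadow_setF (s phi : R) (y a : C2) :
  0 < s <= 1 -> shadow s y -> setF a -> dft a 0 = expi phi ->
  norm (minus y a) ^ 2 <= 2 * (1 - cos (-2 * ln s - phi)) + 2 * s ^ 2.
Proof.
  intros Hs [Ey0 Ey1] (_ & Ha0 & Ha1) Ea.
  rewrite sqr_norm_minus, Ey0, Ey1, Ea. unfold sqdist. rewrite Ha0, Ha1, cos_minus.
  unfold expi, Re, Im; cbn [fst snd].
  assert (Hu := sqr_cos_sin (-2 * ln s)). assert (Hv := sqr_cos_sin phi).
  assert (Hq := sqr_sqrt_1_minus s ltac:(lra)).
  assert (Hq0 := sqrt_pos (1 - s ^ 2)).
  set (w := sqrt (1 - s ^ 2)) in *.
  (* The second coefficient contributes [s^2 + (w - 1)^2 = 2 - 2 w <= 2 - 2 w^2 = 2 s^2]. *)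
  assert (w <= 1) by nra. assert (w ^ 2 <= w) by nra.
  lra.
Qed.

(** * Accumulation points and limits in terms of the norm *)

Lemma norm_minus_sym (x y : C2) : norm (minus x y) = norm (minus y x).
Proof. now rewrite <- norm_opp, opp_minus. Qed.

Lemma norm_minus_triangle (x y z : C2) :
  norm (minus x z) <= norm (minus x y) + norm (minus y z).
Proof. rewrite (minus_trans y). apply norm_triangle. Qed.

Lemma accumulation_point_norm (u : nat -> C2) (a : C2) :
  (forall eps N, 0 < eps -> exists n, (N <= n)%nat /\ norm (minus (u n) a) < eps) ->
  accumulation_point u a.
Proof.
  intros H V HV N. apply locally_norm_le_locally in HV. destruct HV as [eps HV].
  destruct (H eps N (cond_pos eps)) as [n [Hn Hlt]].
  exists n; split; [exact Hn | exact (HV _ Hlt)].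
Qed.

(** Serves to refute convergence by exhibiting two distinct accumulation points. *)
Lemma accumulation_point_lim (u : nat -> C2) (a l : C2) :
  accumulation_point u a -> converges_to u l -> a = l.
Proof.
  intros Ha Hl. apply ball_norm_eq. intros eps.
  apply filterlim_locally_ball_norm with (eps := pos_div_2 eps) in Hl.
  destruct Hl as [N HN].
  destruct (Ha (ball_norm a (pos_div_2 eps))) with (N := N) as [n [Hn Hball]].
  { apply locally_le_locally_norm. exists (pos_div_2 eps). auto. }
  rewrite <- (Rplus_half_diag eps). apply ball_norm_triangle with (u n); [exact Hball |].
  apply (ball_norm_sym l (u n) (pos_div_2 eps)), HN, Hn.
Qed.

Lemma converges_to_zero (u : nat -> C2) (b : nat -> R) :
  (forall k, norm (u k) <= b k) -> is_lim_seq b 0 -> converges_to u zero.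
Proof.
  intros Hu Hb. apply filterlim_locally_ball_norm. intros eps.
  apply is_lim_seq_spec in Hb. destruct (Hb eps) as [N HN]. exists N. intros n Hn.
  unfold ball_norm.
  match goal with |- norm ?z < _ => replace z with (u n) by 
    (symmetry; exact (minus_zero_r (G := NormedModule.AbelianGroup _ C2) (u n))) end.
  specialize (HN n Hn). rewrite Rminus_0_r in HN.
  apply Rle_lt_trans with (1 := Hu n), Rle_lt_trans with (2 := HN), Rle_abs.
Qed.

(** * Parameters and phases along the iteration *)

Section Sequences.

Variables (s : nat -> R) (x y : nat -> C2).
Hypothesis Hx : forall k, on_arc (s k) (x k).
Hypothesis Hy : forall k, shadow (s k) (y k).
Hypothesis Hmin : forall k t, 0 < t <= 1 -> gap (s (S k)) (s k) <= gap t (s k).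

Let Hs k : 0 < s k <= 1 := proj1 (Hx k).

Lemma step_bounds (k : nat) : s (S k) <= s k /\ s k - s (S k) <= s k ^ 2.
Proof. apply argmin_gap_bounds; [apply Hs | apply Hs | apply Hmin, Hs]. Qed.

Lemma eventually_small (e : R) : 0 < e -> exists N, forall n, (N <= n)%nat -> s n < e.
Proof.
  intros He. assert (H := argmin_gap_lim s Hs Hmin). apply is_lim_seq_spec in H.
  destruct (H (mkposreal e He)) as [N HN]. exists N. intros n Hn.
  specialize (HN n Hn). simpl in HN. rewrite Rminus_0_r in HN.
  apply Rle_lt_trans with (2 := HN), Rle_abs.
Qed.

Lemma phase_step (k : nat) : s k <= / 2 -> ln (s k) - ln (s (S k)) <= 2 * s k.
Proof.
  intros H2. destruct (step_bounds k) as [_ H].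
  assert (H0 := Hs k). assert (H1 := Hs (S k)).
  (* For [s k <= / 2] one has [(1 - s k) (1 + 2 s k) >= 1]; then [1 + u <= exp u] prepares the
     logarithm. *)
  assert (H3 : s k <= s (S k) * (1 + 2 * s k)).
  { apply Rle_trans with ((s k - s k ^ 2) * (1 + 2 * s k)); [nra |].
    apply Rmult_le_compat_r; lra. }
  assert (H4 : s k <= s (S k) * exp (2 * s k)).
  { apply Rle_trans with (1 := H3). apply Rmult_le_compat_l; [lra |].
    apply Rlt_le, exp_ineq1. lra. }
  apply ln_le in H4; [| lra].
  rewrite ln_mult, ln_exp in H4; [lra | lra | apply exp_pos].
Qed.

Lemma phase_dense (phi eps : R) (N : nat) :
  0 < eps -> exists n, (N <= n)%nat /\ 1 - cos (-2 * ln (s n) - phi) < eps.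
Proof.
  apply (slowly_divergent_phase_dense (fun n => -2 * ln (s n))).
  (* The phase exceeds [M] exactly when the parameter is below [exp (- M / 2)]. *)
  - intros M. destruct (eventually_small (exp (- M / 2)) (exp_pos _)) as [K HK].
    exists K. intros n Hn. specialize (HK n Hn).
    apply ln_increasing in HK; [| apply Hs]. rewrite ln_exp in HK. lra.
  (* [/ 2] permits [phase_step], which bounds the phase increment by [4 s n < e]. *)
  - intros e He. destruct (eventually_small (Rmin (/ 2) (e / 4))) as [K HK].
    { apply Rmin_pos; lra. }
    exists K. intros n Hn. specialize (HK n Hn).
    assert (H1 := Rmin_l (/ 2) (e / 4)). assert (H2 := Rmin_r (/ 2) (e / 4)).
    assert (H3 := phase_step n ltac:(lra)). lra.
Qed.

Lemma norm_minus_x_y (k : nat) : norm (minus (x k) (y k)) = s k ^ 2.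
Proof. rewrite norm_minus_sym. now apply norm_shadow_self. Qed.

Lemma approach_setF (a : C2) (eps : R) (N : nat) : setF a -> 0 < eps ->
  exists n, (N <= n)%nat /\ norm (minus (x n) a) < eps /\ norm (minus (y n) a) < eps.
Proof.
  intros Ha Heps. destruct (unit_circle_arg _ (proj1 Ha)) as [phi Hphi].
  (* The two tolerances each contribute at most [eps^2 / 8] to the squared distance from [y n] to
     [a], and [x n] is within [s n ^ 2 < eps / 4] of [y n]. *)
  destruct (eventually_small (eps / 4)) as [K HK]; [lra |].
  destruct (phase_dense phi (eps ^ 2 / 16) (max N K)) as [n [Hn Hc]]; [nra |].
  exists n. split; [lia |]. specialize (HK n ltac:(lia)).
  assert (Hsn := Hs n).
  assert (Hya := dist_shadow_setF (s n) phi (y n) a Hsn (Hy n) Ha Hphi).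
  assert (Hy2 : norm (minus (y n) a) < eps / 2).
  { apply Rnot_le_lt. intros C.
    assert ((eps / 2) ^ 2 <= norm (minus (y n) a) ^ 2) by (apply pow_incr; lra).
    assert (s n ^ 2 <= (eps / 4) ^ 2) by (apply pow_incr; lra).
    nra. }
  split; [| lra].
  apply Rle_lt_trans with (1 := norm_minus_triangle (x n) (y n) a).
  rewrite norm_minus_x_y. nra.
Qed.

End Sequences.

(** * Application to error reduction sequences *)

(** The real part of the second coefficient recovers the arc parameter, so the sequence [s] is
    defined without choice. *)
Lemma gerchberg_saxton_arc (x y : nat -> C2) :
  gerchberg_saxton setA setB x y -> ~ setF (x 0%nat) ->
  let s := fun k => Re (dft (x k) 1) in
  (forall k, on_arc (s k) (x k)) /\ (forall k, shadow (s k) (y k)) /\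
  (forall k t, 0 < t <= 1 -> gap (s (S k)) (s k) <= gap t (s k)).
Proof.
  intros [H0 Hstep] HF s.
  assert (Es : forall k r, on_arc r (x k) -> r = s k).
  { intros k r Hr. unfold s. now rewrite (proj2 (on_arc_coords r _ Hr)). }
  assert (Hx : forall k, on_arc (s k) (x k)).
  { induction k as [| k IH].
    - destruct (setA_cases _ H0) as [[r Hr] | C]; [| contradiction].
      now rewrite <- (Es _ _ Hr).
    - destruct (Hstep k) as [HB HA].
      destruct (error_reduction_step _ _ _ _ IH HB HA) as [r [Hr _]].
      now rewrite <- (Es _ _ Hr). }
  split; [exact Hx | split].
  - intros k. exact (proj_setB_on_arc _ _ _ (Hx k) (proj1 (Hstep k))).
  - intros k. destruct (Hstep k) as [HB HA].
    destruct (error_reduction_step _ _ _ _ (Hx k) HB HA) as [r [Hr Hmin]].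
    rewrite <- (Es _ _ Hr). exact Hmin.
Qed.

(** First coefficients [1] and [-1]; these two accumulation points exclude a limit. *)
Lemma setF_two_points : exists a b, setF a /\ setF b /\ a <> b.
Proof.
  destruct (dft_surjective (1, 0) (0, 1)) as [a [Ea0 Ea1]].
  destruct (dft_surjective (-1, 0) (0, 1)) as [b [Eb0 Eb1]].
  exists a, b. unfold setF. rewrite Ea0, Ea1, Eb0, Eb1, !Cmod_1_sqr.
  unfold Re, Im; cbn [fst snd]. repeat split; try ring.
  intros ->. rewrite Ea0 in Eb0. injection Eb0. lra.
Qed.

Theorem theorem5 :
  (forall x y : nat -> C2,
     gerchberg_saxton setA setB x y -> ~ setF (x 0%nat) ->
     ~ (exists l : C2, converges_to x l) /\
     ~ (exists l : C2, converges_to y l) /\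
     converges_to (fun k => minus (x k) (x (S k))) zero /\
     converges_to (fun k => minus (y k) (y (S k))) zero /\
     converges_to (fun k => minus (x k) (y k)) zero /\
     (forall xs : C2, setF xs ->
        accumulation_point x xs /\ accumulation_point y xs)) /\
  (forall xs : C2, setF xs -> setA xs /\ setB xs).
Proof.
  split.
  - intros x y HGS HF.
    destruct (gerchberg_saxton_arc x y HGS HF) as (Hx & Hy & Hmin).
    set (s := fun k => Re (dft (x k) 1)) in *.
    assert (Hs : forall k, 0 < s k <= 1) by (intros k; apply Hx).
    assert (Hxy := norm_minus_x_y s x y Hx Hy).
    (* A common majorant: each of the three differences has norm at most a sum of two squares of
       parameters bounded by [s k <= 1]. *)
    assert (Hb : is_lim_seq (fun k => 2 * s k) 0).
    { replace (Finite 0) with (Rbar_mult 2 0) by (simpl; now rewrite Rmult_0_r).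
      apply is_lim_seq_scal_l. exact (argmin_gap_lim s Hs Hmin). }
    (* [x k] itself competes in the projection that yields [x (S k)]. *)
    assert (Hyx : forall k, norm (minus (y k) (x (S k))) <= s k ^ 2).
    { intros k. rewrite <- Hxy, (norm_minus_sym (x k)). apply (proj2 (proj2 (proj2 HGS k))).
      exact (on_arc_setA _ _ (Hx k)). }
    assert (Hacc : forall a, setF a -> accumulation_point x a /\ accumulation_point y a).
    { intros a Ha.
      split; apply accumulation_point_norm; intros eps N Heps;
        destruct (approach_setF s x y Hx Hy Hmin a eps N Ha Heps) as [n [Hn [H1 H2]]];
        exists n; split; assumption. }
    destruct setF_two_points as (a & b & Ha & Hb' & Hab).
    repeat split.
    + intros [l Hl]. apply Hab.
      transitivity l; [| symmetry]; apply (accumulation_point_lim x); try assumption; now apply Hacc.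
    + intros [l Hl]. apply Hab.
      transitivity l; [| symmetry]; apply (accumulation_point_lim y); try assumption; now apply Hacc.
    + apply converges_to_zero with (2 := Hb). intros k.
      apply Rle_trans with (1 := norm_minus_triangle _ (y k) _).
      rewrite Hxy. specialize (Hs k). specialize (Hyx k). nra.
    + apply converges_to_zero with (2 := Hb). intros k.
      apply Rle_trans with (1 := norm_minus_triangle _ (x (S k)) _).
      rewrite Hxy. assert (Hk := Hs k). assert (HSk := Hs (S k)). specialize (Hyx k).
      destruct (step_bounds s x Hx Hmin k). nra.
    + apply converges_to_zero with (2 := Hb). intros k.
      rewrite Hxy. specialize (Hs k). nra.
    + now apply Hacc.
    + now apply Hacc.
  - intros a Ha. split; [right; exact Ha |].
    destruct Ha as (H0 & H1 & H2). split; [exact H0 |].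
    apply Cmod_1_sqr. rewrite H1, H2. ring.
Qed.
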